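(* Let $\theta>0$ and let $C_j^{\eta}(n)$ be the number of cycles of size $j$ in the playground game process $\eta^{n,\theta}$. For any $j\ge 2$ and $m\ge 1$, $$\begin{aligned}\lim_{n\to\infty}\mathbb{E}(C^{\eta}_{j}(n))&=\mathbf{1}(j\ge 3)\frac{\theta(j-2)!}{(\theta+2)_{(j-3)}}\int_0^1 e^{-\theta x}(1-x)^{\theta+j-1}\,dx+\mathbf{1}(j=2)\,\theta\int_0^1 e^{-\theta x}(1-x)^{\theta+1}\,dx\\&\quad+\sum_{k=1}^{2m}(-1)^{k+1}\bar b_k(\theta,j)+\varepsilon(m,\theta,j),\end{aligned}$$ with $\varepsilon(m,\theta,j)\le\bar b_{2m+1}(\theta,j)$, where $$\bar b_k(\theta,j)=\frac{\theta^{k}(k-1)!\,\bigl(k(j-1)+\theta(k+j-1)\bigr)}{(\theta+1)_{(k)}(j-1)_{(k+1)}}-\frac{\theta^{k}(j-2)!\,\bigl((k-1+(\theta+1)j)(\theta+j)-k\bigr)}{(\theta+1)_{(k+j)}}.$$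
   Context: Playground game process: fix $\theta>0$ and put $p_1=0$, $p_2=1$, $p_i=\frac{i-1}{i-1+\theta}$ for $i\ge 3$, $q_i=1-p_i$. For $n\ge 2$, $\eta=\eta^{n,\theta}=(\eta_{n+1}=1,\eta_n,\dots,\eta_1)$ is the $\{0,1\}$-valued inhomogeneous Markov chain, run in decreasing index and started from $\eta_{n+1}=1$, such that $\eta_n=0$ a.s., $\eta_1=1$ a.s., and for $2\le r\le n-1$: $\mathbb{P}(\eta_r=0\mid\eta_{r+1}=0)=p_r$, $\mathbb{P}(\eta_r=1\mid\eta_{r+1}=0)=q_r$, $\mathbb{P}(\eta_r=0\mid\eta_{r+1}=1)=1$. $C_j^{\eta}(n)$ is the number of $j$-spacings between consecutive $1$s in the sequence $(1,\eta_n,\dots,\eta_1)$, i.e. the number of occurrences of the pattern $1\,0^{j-1}\,1$. Notation: $x_{(m)}=x(x+1)\cdots(x+m-1)$ for $m\ge 1$, $x_{(0)}=1$. *)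

(* Defs.v *)
From HB Require Import structures.
From mathcomp Require Import all_boot all_order all_algebra.
From mathcomp Require Import all_classical all_reals all_analysis.

Set Implicit Arguments.
Unset Strict Implicit.
Unset Printing Implicit Defensive.

Import Order.TTheory GRing.Theory Num.Theory.
Import numFieldNormedType.Exports.

Local Open Scope classical_set_scope.
Local Open Scope ring_scope.

(* The rising factorial x_(m) = x (x + 1) ... (x + m - 1), with x_(0) = 1. *)
Definition rising (R : realType) (x : R) (m : nat) : R :=
  \prod_(i < m) (x + i%:R).

(* The value at i = 0 is never used. *)
Definition pg_p (R : realType) (theta : R) (i : nat) : R :=
  match i with
  | 0 | 1 => 0
  | 2 => 1
  | k.+1 => k%:R / (k%:R + theta)
  end.

Definition pg_q (R : realType) (theta : R) (i : nat) : R := 1 - pg_p theta i.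

(* Junk value 0 when P B = 0; it is only used when P B != 0. *)
Definition cond_prob d (T : measurableType d) (R : realType)
    (P : probability T R) (A B : set T) : R :=
  fine (P (A `&` B)) / fine (P B).

(* The event (eta_i = h_i for all r <= i <= s). *)
Definition history d (T : measurableType d) (R : realType)
    (P : probability T R) (eta : nat -> {RV P >-> bool})
    (r s : nat) (h : nat -> bool) : set T :=
  [set w | forall i, (r <= i <= s)%N -> eta i w = h i].

(* (eta_{n+1}, eta_n, ..., eta_1), in decreasing index, has the Markov
   property. *)
Definition markov_decreasing d (T : measurableType d) (R : realType)
    (P : probability T R) (n : nat) (eta : nat -> {RV P >-> bool}) : Prop :=
  forall (r : nat) (h : nat -> bool), (1 <= r <= n)%N ->
    P (history eta r.+1 n.+1 h) != 0%E ->
    cond_prob P (eta r @^-1` [set h r]) (history eta r.+1 n.+1 h) =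
    cond_prob P (eta r @^-1` [set h r]) (eta r.+1 @^-1` [set h r.+1]).

(* eta has the law of eta^{n,theta}; 1 and 0 are encoded as true and false.
   Only eta 1, ..., eta n.+1 are meaningful. A transition probability is
   prescribed only from states of positive probability. *)
Record playground d (T : measurableType d) (R : realType)
    (P : probability T R) (theta : R) (n : nat)
    (eta : nat -> {RV P >-> bool}) : Prop := Playground {
  pg_start : P (eta n.+1 @^-1` [set true]) = 1%E ;
  pg_top : P (eta n @^-1` [set false]) = 1%E ;
  pg_bottom : P (eta 1%N @^-1` [set true]) = 1%E ;
  pg_markov : markov_decreasing n eta ;
  pg_trans00 : forall r, (2 <= r <= n.-1)%N ->
    P (eta r.+1 @^-1` [set false]) != 0%E ->
    cond_prob P (eta r @^-1` [set false]) (eta r.+1 @^-1` [set false]) =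
    pg_p theta r ;
  pg_trans01 : forall r, (2 <= r <= n.-1)%N ->
    P (eta r.+1 @^-1` [set false]) != 0%E ->
    cond_prob P (eta r @^-1` [set true]) (eta r.+1 @^-1` [set false]) =
    pg_q theta r ;
  pg_trans10 : forall r, (2 <= r <= n.-1)%N ->
    P (eta r.+1 @^-1` [set true]) != 0%E ->
    cond_prob P (eta r @^-1` [set false]) (eta r.+1 @^-1` [set true]) = 1
}.

(* The number of occurrences of the pattern 1 0^{j-1} 1 in
   (x_{n+1}, x_n, ..., x_1); the index r is the position of the last 1. *)
Definition spacings (n j : nat) (x : nat -> bool) : nat :=
  (\sum_(1 <= r < n.+2 | (r + j <= n.+1)%N)
     [&& x (r + j), all (fun i => ~~ x i) (iota r.+1 j.-1) & x r])%N.

(* C_j^eta(n), as a real-valued function on the sample space. *)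
Definition cycle_count d (T : measurableType d) (R : realType)
    (P : probability T R) (eta : nat -> {RV P >-> bool}) (n j : nat)
    (w : T) : R :=
  (spacings n j (fun i => eta i w))%:R.

Definition bbar (R : realType) (k : nat) (theta : R) (j : nat) : R :=
  theta ^+ k * (k.-1)`!%:R
    * (k%:R * (j%:R - 1) + theta * (k%:R + j%:R - 1))
    / (rising (theta + 1) k * rising (j%:R - 1) k.+1)
  - theta ^+ k * (j - 2)`!%:R
    * ((k%:R - 1 + (theta + 1) * j%:R) * (theta + j%:R) - k%:R)
    / rising (theta + 1) (k + j).

(* At j = 2 the truncated j - 3 occurs only under a zero indicator. *)
Definition main_term (R : realType) (theta : R) (j : nat) : R :=
  (3 <= j)%N%:R * (theta * (j - 2)`!%:R / rising (theta + 2) (j - 3)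
    * \int[lebesgue_measure]_(x in `[0, 1])
        (expR (- theta * x) * (1 - x) `^ (theta + j%:R - 1)))
  + (j == 2%N)%:R * (theta
    * \int[lebesgue_measure]_(x in `[0, 1])
        (expR (- theta * x) * (1 - x) `^ (theta + 1))).

(* Main.v *)
(* The Markov property gives E C_j(n) = sum_r w_r u_n(r + j), where
   u_n(r) = P(eta_r = 1) and w_r is the probability that a 1 at r + j is
   followed by j - 1 zeros and a 1 at r. The u_n satisfy
   u(r) = q_r (1 - u(r + 1)), and so do, by integration by parts, the numbers
   v(r) = theta * int_0^1 e^(- theta x) (1 - x)^(theta + r - 2) dx. Since
   q_r <= theta / (2 + theta) for r >= 3, u_n - v decays geometrically away from
   r = n, while w_r = O(1 / r); hence E C_j(n) tends to sum_r w_r v(r + j).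
   The term r = 1 is the main term and the term r = 2 vanishes. Iterating the
   recursion, v is bounded above by the odd partial sums of the alternating
   series of products q_r q_(r+1) ... q_(r+k-1); summed over r >= 3 against w_r,
   the k-th product gives bbar_k, by Gauss's summation theorem for 2F1 at 1
   from which the terms r = 1, 2 are subtracted. *)
Require Import Defs.
From HB Require Import structures.
From mathcomp Require Import all_boot all_order all_algebra.
From mathcomp Require Import all_classical all_reals all_analysis.
From mathcomp Require Import measurable_realfun ring lra zify.

Set Implicit Arguments.
Unset Strict Implicit.
Unset Printing Implicit Defensive.

Import Order.TTheory GRing.Theory Num.Theory.
Import numFieldNormedType.Exports.

Local Open Scope classical_set_scope.
Local Open Scope ring_scope.

(** * Integrals of e^(- theta x) (1 - x)^a and their recursion *)

Lemma is_derive1_powR1B (R : realType) (a x : R) : x < 1 ->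
  is_derive x 1 (fun y => (1 - y) `^ a) (- (a * (1 - x) `^ (a - 1))).
Proof.
move=> x1; have x1' : 0 < 1 - x by rewrite subr_gt0.
have := is_derive1_powR a x1' => dp.
have db : is_derive x 1 (fun y : R => 1 - y) (- 1).
  apply: is_derive_eq. by rewrite add0r mul1r.
have := @is_derive1_comp _ (fun y : R => y `^ a) (fun y : R => 1 - y)
  x _ _ dp db.
by rewrite mulrN1.
Qed.

Section beta_exp_integral.
Variable R : realType.
Implicit Types (theta a x : R).

(** At [a = theta + j - 1] this is the integrand of [main_term], for [j = 2] as well. *)
Definition beta_exp theta a x : R := expR (- theta * x) * (1 - x) `^ a.

(** The exponent is written [a + 1] so that both terms of the derivative are again values of
    [beta_exp]. *)
Lemma is_derive_beta_exp theta a x : x < 1 ->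
  is_derive x 1 (beta_exp theta (a + 1))
    (- (theta * beta_exp theta (a + 1) x) - (a + 1) * beta_exp theta a x).
Proof.
move=> x1.
have dp := is_derive1_powR1B (a + 1) x1.
have de : is_derive x 1 (fun y : R => expR (- theta * y))
    (- theta * expR (- theta * x)).
  have dl : is_derive x 1 (fun y : R => - theta * y) (- theta).
    by apply: is_derive_eq; rewrite /GRing.scale/= mulr1.
  have := is_derive_expR (- theta * x) => de.
  have := @is_derive1_comp _ expR (fun y : R => - theta * y) x _ _ de dl.
  by rewrite mulrC.
apply: is_derive_eq.
rewrite /GRing.scale/= /beta_exp addrK; ring.
Qed.

Lemma beta_exp_cvg_left theta a : 1 <= a ->
  beta_exp theta a x @[x --> 1^'-] --> 0.
Proof.
move=> a1; rewrite -[X in _ --> X](mulr0 (expR (- theta * 1))).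
apply: cvgM.
  apply: cvg_at_left_filter.
  apply: continuous_comp; last exact: continuous_expR.
  by apply: continuousM => //; exact: cvg_cst.
(* For [0 <= x < 1] and [a >= 1], the power of [1 - x] lies between 0 and [1 - x]. *)
apply: (@squeeze_cvgr _ _ _ _ (cst 0) (fun x => 1 - x)); last 2 first.
- exact: cvg_cst.
- rewrite -[X in _ --> X](subrr (1 : R)); apply: cvg_at_left_filter.
  by apply: cvgB; [exact: cvg_cst|exact: cvg_id].
near=> x; rewrite powR_ge0/= ge1r_powR// subr_gt0 gerBl.
by apply/andP; split; near: x; [exact: nbhs_left_lt|exact: nbhs_left_ge].
Unshelve. all: by end_near. Qed.

Lemma beta_exp_continuous theta a x : x < 1 ->
  {for x, continuous (beta_exp theta a)}.
Proof.
move=> x1; have d := is_derive_beta_exp theta (a - 1) x1.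
apply: differentiable_continuous; apply/derivable1_diffP.
by rewrite -[a](subrK 1).
Qed.

Lemma beta_exp1 theta a : a != 0 -> beta_exp theta a 1 = 0.
Proof. by move=> a0; rewrite /beta_exp subrr powR0// mulr0. Qed.

Lemma beta_exp_derivable theta a : 1 <= a ->
  derivable_oo_LRcontinuous (beta_exp theta a) 0 1.
Proof.
move=> a1; split.
- move=> x; rewrite in_itv/= => /andP[_ x1].
  by have := is_derive_beta_exp theta (a - 1) x1; rewrite subrK.
- exact/cvg_at_right_filter/beta_exp_continuous.
- rewrite beta_exp1; first exact: beta_exp_cvg_left.
  by rewrite gt_eqF// (lt_le_trans ltr01).
Qed.

Lemma beta_exp_integrable theta a : 1 <= a ->
  lebesgue_measure.-integrable `[0, 1] (EFin \o beta_exp theta a).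
Proof.
move=> a1; apply: continuous_compact_integrable; first exact: segment_compact.
exact/derivable_oo_LRcontinuous_within/beta_exp_derivable.
Qed.

(** Since [beta_exp theta (a + 1)] falls from 1 at 0 to 0 at 1, its derivative [f] integrates to -
    1; this relates the integrals at [a] and [a + 1] linearly. *)
Lemma integral_beta_exp_rec theta a : 1 <= a ->
  \int[lebesgue_measure]_(x in `[0, 1]) beta_exp theta a x =
  (1 - theta * \int[lebesgue_measure]_(x in `[0, 1]) beta_exp theta (a + 1) x)
    / (a + 1).
Proof.
move=> a1; have a2 : 1 <= a + 1 by rewrite ler_wpDl// (le_trans ler01).
have a0 : a + 1 != 0 by rewrite gt_eqF// (lt_le_trans ltr01).
pose f := - theta \*o beta_exp theta (a + 1) \- ((a + 1) \*o beta_exp theta a).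
have i1 := beta_exp_integrable theta a1.
have i2 := beta_exp_integrable theta a2.
have iN : lebesgue_measure.-integrable `[0, 1]
    (EFin \o - theta \*o beta_exp theta (a + 1)).
  by have := integrableZl _ (- theta) i2; apply.
have iP : lebesgue_measure.-integrable `[0, 1]
    (EFin \o (a + 1) \*o beta_exp theta a).
  by have := integrableZl _ (a + 1) i1; apply.
have : \int[lebesgue_measure]_(x in `[0, 1]) f x = - 1.
  rewrite /Rintegral.
  rewrite (@continuous_FTC2 _ f (beta_exp theta (a + 1)) 0 1) ?ltr01//;
    first last.
  - move=> x; rewrite in_itv/= => /andP[_ x1].
    rewrite derive1E; have [_ ->] := is_derive_beta_exp theta a x1.
    by rewrite /f/= mulNr.
  - exact: beta_exp_derivable.
  - have c1 := derivable_oo_LRcontinuous_within (beta_exp_derivable theta a1).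
    have c2 := derivable_oo_LRcontinuous_within (beta_exp_derivable theta a2).
    by move=> x; apply: cvgB; apply: cvgM;
      [exact: cvg_cst|exact: c2|exact: cvg_cst|exact: c1].
  rewrite beta_exp1// /beta_exp mulr0 expR0 subr0 powR1 mulr1/= sub0r//.
rewrite RintegralB// !RintegralZl//.
move: (\int[_]_(x in _) _) (\int[_]_(x in _) _) => u v uv.
by apply: (mulIf a0); rewrite divfK//; move: uv; clear; lra.
Qed.

End beta_exp_integral.

(** * Probabilities as real numbers, and conditioning *)

Section fine_probability.
Context d (T : measurableType d) (R : realType) (P : probability T R).
Implicit Types A B : set T.

Lemma fine_probability_ge0 A : 0 <= fine (P A).
Proof. exact: fine_ge0. Qed.

Lemma fine_probabilityDI A B : measurable A -> measurable B ->
  fine (P A) = fine (P (A `\` B)) + fine (P (A `&` B)).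
Proof.
move=> mA mB; rewrite [in LHS](measureDI _ mA mB) fineD// fin_num_measure//.
- exact: measurableD.
- exact: measurableI.
Qed.

Lemma fine_probability_setIl A B : measurable A -> measurable B ->
  fine (P (A `&` B)) <= fine (P B).
Proof.
move=> mA mB; rewrite (fine_probabilityDI mB mA) setIC lerDr.
exact: fine_probability_ge0.
Qed.

Lemma probability1_setI A B : measurable A -> measurable B ->
  P A = 1%E -> fine (P (A `&` B)) = fine (P B).
Proof.
move=> mA mB PA; rewrite (fine_probabilityDI mB mA) [B `&` A]setIC.
suff -> : fine (P (B `\` A)) = 0 by rewrite add0r.
apply/eqP; rewrite eq_le fine_probability_ge0 andbT.
rewrite setDE; apply: le_trans (fine_probability_setIl mB (measurableC mA)) _.
by rewrite probability_setC// PA subee.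
Qed.

(** When [P B = 0] both sides vanish, so this product form is insensitive to the default value of
    [cond_prob]. *)
Lemma cond_probM A B : measurable A -> measurable B ->
  fine (P B) * cond_prob P A B = fine (P (A `&` B)).
Proof.
move=> mA mB; rewrite /cond_prob; have [PB0|PB0] := eqVneq (fine (P B)) 0.
  rewrite PB0 mul0r; apply/eqP; rewrite eq_le fine_probability_ge0/=.
  by rewrite -[leRHS]PB0 fine_probability_setIl.
by rewrite mulrC divfK.
Qed.

Lemma fine_probability_neq0 A : fine (P A) != 0 -> P A != 0%E.
Proof. by apply: contra_neq => ->. Qed.

End fine_probability.

(** * Histories and the Markov property *)

Section markov_chain.
Context d (T : measurableType d) (R : realType) (P : probability T R).
Variable eta : nat -> {RV P >-> bool}.
Implicit Types (r s n : nat) (h : nat -> bool).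

Lemma measurable_state r b : measurable (eta r @^-1` [set b]).
Proof. exact: measurable_funPTI. Qed.

Lemma measurable_history r s h : measurable (history eta r s h).
Proof. by apply: bigcap_measurableType => i _; exact: measurable_state. Qed.

Lemma eq_history r s h h' : (forall i, (r <= i <= s)%N -> h i = h' i) ->
  history eta r s h = history eta r s h'.
Proof.
by move=> hh'; apply/seteqP; split => w hw i /[dup] ris /hw ->; rewrite hh'.
Qed.

Lemma history_recl r s h : (r <= s)%N ->
  history eta r s h = eta r @^-1` [set h r] `&` history eta r.+1 s h.
Proof.
move=> rs; apply/seteqP; split => [w hw|w [hr hw] i /andP[]].
  split; first by apply: hw; rewrite leqnn.
  by move=> i /andP[ri si]; apply: hw; rewrite si (ltnW ri).
by rewrite leq_eqVlt => /predU1P[<- _//|ri si]; apply: hw; rewrite ri.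
Qed.

Lemma history_recr r s h : (r <= s.+1)%N ->
  history eta r s.+1 h = history eta r s h `&` eta s.+1 @^-1` [set h s.+1].
Proof.
move=> rs; apply/seteqP; split => [w hw|w [hw hs] i /andP[ri]].
  split; last by apply: hw; rewrite rs leqnn.
  by move=> i /andP[ri si]; apply: hw; rewrite ri (leqW si).
by rewrite leq_eqVlt => /predU1P[->//|si]; apply: hw; rewrite ri.
Qed.

(** Total probability over the state at [s + 1], where [h'] overrides [h]. *)
Lemma history_split r s h A : measurable A -> (r <= s.+1)%N ->
  let h' b i := if i == s.+1 then b else h i in
  fine (P (A `&` history eta r s h)) =
  fine (P (A `&` history eta r s.+1 (h' false))) +
  fine (P (A `&` history eta r s.+1 (h' true))).
Proof.
move=> mA rs h'; have mh := measurable_history r s h.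
have eh b : history eta r s (h' b) = history eta r s h.
  apply: eq_history => i /andP[_ si]; rewrite /h' ifN//.
  by rewrite neq_ltn ltnS si.
rewrite !history_recr// !eh /h' eqxx !setIA.
rewrite (fine_probabilityDI P (measurableI _ _ mA mh)
  (measurable_state s.+1 true)).
congr (fine (P _) + _); rewrite setDE; congr (_ `&` _).
by apply/seteqP; split => w /=; case: (eta s.+1 w).
Qed.

(* The Markov property conditions on the whole past up to n + 1; summing over
   the values at s + 1, ..., n + 1 extends it to a window ending at s. *)
Lemma markov_history n r s h : markov_decreasing n eta ->
  (1 <= r)%N -> (r < s <= n.+1)%N ->
  fine (P (history eta r s h)) = fine (P (history eta r.+1 s h)) *
    cond_prob P (eta r @^-1` [set h r]) (eta r.+1 @^-1` [set h r.+1]).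
Proof.
move=> mk r1 /andP[rs sn]; move: (subnKC sn); move: (n.+1 - s)%N => k.
(* Induction on [k = n + 1 - s]. At [k = 0] the window is the whole past and the assumption applies,
   unless that past is null and both sides vanish. *)
elim: k s rs {sn} h => [|k IH] s rs h.
  rewrite addn0 => sn; rewrite history_recl ?(ltnW rs)//.
  rewrite -cond_probM; [|exact: measurable_state|exact: measurable_history].
  have [->|H0] := eqVneq (fine (P (history eta r.+1 s h))) 0.
    by rewrite !mul0r.
  rewrite sn mk//; first by rewrite r1 -ltnS -sn.
  by apply: fine_probability_neq0; rewrite -sn.
rewrite addnS -addSn => sn.
pose h' b i := if i == s.+1 then b else h i.
have E b : fine (P (history eta r s.+1 (h' b))) =
    fine (P (history eta r.+1 s.+1 (h' b))) *
    cond_prob P (eta r @^-1` [set h r]) (eta r.+1 @^-1` [set h r.+1]).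
  rewrite IH//; last exact: ltnW.
  by rewrite /h' !ltn_eqF// ltnS ltnW.
rewrite -[history eta r s h]setTI -[history eta r.+1 s h]setTI.
rewrite (history_split h measurableT (leqW (ltnW rs))).
by rewrite (history_split h measurableT (leqW rs)) !setTI !E mulrDl.
Qed.

End markov_chain.

(* At r = 1 the factor pg_q theta 1 = 1 matches eta_1 = 1 a.s. *)
Definition spacing_weight (R : realType) (theta : R) (j r : nat) : R :=
  pg_q theta r * \prod_(r.+1 <= i < (r + j).-1) pg_p theta i.

(** * Law of the playground chain and expected number of spacings *)

Section playground_law.
Context d (T : measurableType d) (R : realType) (P : probability T R).
Variables (theta : R) (n : nat) (eta : nat -> {RV P >-> bool}).
Hypothesis pg : playground theta n eta.
Implicit Types (r s j : nat) (h : nat -> bool).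

Let u r : R := fine (P (eta r @^-1` [set true])).

Lemma playground_prob_start : u n.+1 = 1.
Proof. by rewrite /u (pg_start pg). Qed.

Lemma playground_prob_false r :
  fine (P (eta r @^-1` [set false])) = 1 - u r.
Proof.
rewrite /u; apply/eqP; rewrite eq_sym subr_eq; apply/eqP.
have := fine_probabilityDI P measurableT (measurable_state eta r true).
rewrite probability_setT/= => ->; congr (fine (P _) + fine (P _)).
  by apply/seteqP; split => w /=; case: (eta r w); intuition.
by rewrite setTI.
Qed.

Lemma playground_prob_top : u n = 0.
Proof. by have := playground_prob_false n; rewrite (pg_top pg)/=; lra. Qed.

(** All transitions in one formula, multiplied by the probability of the source state so as to cover
    null states. *)
Lemma playground_cond r b c : (2 <= r <= n.-1)%N ->
  fine (P (eta r.+1 @^-1` [set c])) *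
    cond_prob P (eta r @^-1` [set b]) (eta r.+1 @^-1` [set c]) =
  fine (P (eta r.+1 @^-1` [set c])) *
    (if c then (~~ b)%:R else if b then pg_q theta r else pg_p theta r).
Proof.
move=> rn; have mc := measurable_state eta r.+1 c.
have [->|c0] := eqVneq (fine (P (eta r.+1 @^-1` [set c]))) 0.
  by rewrite !mul0r.
have {}c0 := fine_probability_neq0 c0.
case: c mc c0 => mc c0; case: b.
(* The transition from 1 to 1 is not prescribed directly: it is null because the transition from 1
   to 0 has probability 1. *)
- have mt := measurable_state eta r true.
  have mf := measurable_state eta r false.
  have := cond_probM P mf mc; rewrite (pg_trans10 pg)// mulr1.
  rewrite cond_probM// mulr0 (fine_probabilityDI P mc mt) => /eqP.
  rewrite setIC [X in X == _]addrC -subr_eq0.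
  suff -> : eta r.+1 @^-1` [set true] `\` eta r @^-1` [set true] =
      eta r @^-1` [set false] `&` eta r.+1 @^-1` [set true].
    by rewrite addrK => /eqP.
  by apply/seteqP; split => w /=; case: (eta r w); intuition.
- by rewrite (pg_trans10 pg).
- by rewrite (pg_trans01 pg).
- by rewrite (pg_trans00 pg).
Qed.

(** Total probability over the state at [r + 1], from which only a 0 can lead to a 1. *)
Lemma playground_rec r : (2 <= r <= n.-1)%N ->
  u r = pg_q theta r * (1 - u r.+1).
Proof.
move=> rn; have ms i b := measurable_state eta i b.
rewrite /u (fine_probabilityDI P (ms r true) (ms r.+1 true)).
have -> : eta r @^-1` [set true] `\` eta r.+1 @^-1` [set true] =
    eta r @^-1` [set true] `&` eta r.+1 @^-1` [set false].
  by apply/seteqP; split => w /=; case: (eta r.+1 w); intuition.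
rewrite -!cond_probM// !playground_cond//= mulr0 addr0 mulrC.
by rewrite playground_prob_false.
Qed.

Lemma playground_step r s h : (2 <= r <= n.-1)%N -> (r < s <= n.+1)%N ->
  fine (P (history eta r s h)) = fine (P (history eta r.+1 s h)) *
    (if h r.+1 then (~~ h r)%:R
     else if h r then pg_q theta r else pg_p theta r).
Proof.
move=> rn rs; have r1 : (1 <= r)%N by case/andP: rn; case: r {rs}.
rewrite (markov_history _ (pg_markov pg))//.
have mh := measurable_history eta r.+1 s h.
have ms := measurable_state eta r.+1 (h r.+1).
have [c0|c0] := eqVneq (fine (P (eta r.+1 @^-1` [set h r.+1]))) 0.
  suff -> : fine (P (history eta r.+1 s h)) = 0 by rewrite !mul0r.
  apply/eqP; rewrite eq_le fine_probability_ge0 andbT -c0.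
  rewrite history_recl; last by case/andP: rs.
  by rewrite setIC fine_probability_setIl//; exact: measurable_history.
by congr (_ * _); apply: (mulfI c0); rewrite playground_cond.
Qed.

(** The zero at [s - 1] follows the 1 at [s] and is certain, so only the zeros at [i <= s - 2]
    contribute a factor [pg_p theta i]. *)
Lemma playground_zeros r s h : (2 <= r < s)%N -> (s <= n.+1)%N ->
  h s -> (forall i, (r <= i < s)%N -> h i = false) ->
  fine (P (history eta r s h)) = u s * \prod_(r <= i < s.-1) pg_p theta i.
Proof.
move=> /andP[r2 rs] sn hs; move: (subnKC rs); move: (s - r.+1)%N => k.
elim: k r r2 {rs} => [|k IH] r r2.
  rewrite addn0 => rs h0; rewrite -{}rs {s} in sn hs h0 *.
  rewrite big_geq// mulr1.
  have hr : h r = false by apply: h0; rewrite leqnn ltnSn.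
  have -> : u r.+1 = fine (P (history eta r.+1 r.+1 h)).
    congr (fine (P _)); apply/seteqP; split => [w wr i|w hw] /=.
      by rewrite -eqn_leq => /eqP <-; rewrite hs.
    by rewrite hw ?leqnn ?hs.
  (* Transitions are prescribed up to [n - 1] only; at [r = n] the zero is almost sure by
     [pg_top]. *)
  have [rn|nr] := ltnP r n.
    rewrite playground_step ?leqnn//; last by lia.
    by rewrite hs hr mulr1.
  have rn : r = n by lia.
  rewrite history_recl// hr probability1_setI//.
  - exact: measurable_state.
  - exact: measurable_history.
  - by rewrite rn (pg_top pg).
rewrite addnS -addSn => rs h0.
have rs' : (r.+1 < s)%N by rewrite -rs ltnS leq_addr.
have hr i : (i = r \/ i = r.+1) -> h i = false.
  by case=> ->; apply: h0; rewrite ?leqnn ?leqnSn ?rs' ?(ltnW rs').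
have rn : (2 <= r <= n.-1)%N by lia.
have rsn : (r < s <= n.+1)%N by rewrite sn (ltnW rs').
rewrite (playground_step h rn rsn) IH//; last 2 first.
- by lia.
- by move=> i /andP[ri si]; apply: h0; rewrite si (ltnW ri).
rewrite (hr r (or_introl erefl)) (hr r.+1 (or_intror erefl)).
rewrite [in RHS]big_ltn; last by lia.
by rewrite -mulrA [X in _ * X]mulrC.
Qed.

Definition spacing_pattern j r i : bool := (i == r) || (i == r + j)%N.

Lemma playground_spacing j r : (2 <= j)%N -> (1 <= r)%N -> (r + j <= n.+1)%N ->
  fine (P (history eta r (r + j) (spacing_pattern j r))) =
  spacing_weight theta j r * u (r + j).
Proof.
move=> j2 r1 rjn; set h := spacing_pattern j r.
have h0 i : (r.+1 <= i < r + j)%N -> h i = false.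
  by move=> ?; apply/negbTE; rewrite /h /spacing_pattern; lia.
have hs : h (r + j) by rewrite /h /spacing_pattern eqxx orbT.
have hr : h r by rewrite /h /spacing_pattern eqxx.
have z : fine (P (history eta r.+1 (r + j) h)) =
    u (r + j) * \prod_(r.+1 <= i < (r + j).-1) pg_p theta i.
  by apply: playground_zeros => //; lia.
rewrite /spacing_weight -mulrA [in RHS]mulrC [\prod_(_ <= _ < _) _ * _]mulrC -z.
(* For [r >= 2] the last 1 comes after a zero, as [j >= 2], and costs [pg_q theta r]; for [r = 1] it
   is almost sure. *)
have [r2|r2] := leqP 2 r.
  by rewrite playground_step ?hr ?h0//; lia.
have {r2 r1} rE : r = 1%N by lia.
rewrite history_recl ?leq_addr// hr rE.
rewrite probability1_setI; first by rewrite /pg_q/= subr0 mulr1.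
- exact: measurable_state.
- exact: measurable_history.
- by rewrite (pg_bottom pg).
Qed.

(** The count is the sum of the indicators of the windows [A r], so linearity reduces the claim to
    [playground_spacing]. *)
Lemma expectation_cycle_count j : (2 <= j)%N ->
  ('E_P[cycle_count eta n j] =
  (\sum_(1 <= r < n.+2 | (r + j <= n.+1)%N)
    spacing_weight theta j r * u (r + j))%R%:E)%E.
Proof.
move=> j2.
pose A r := history eta r (r + j) (spacing_pattern j r).
have mA r : measurable (A r) by exact: measurable_history.
rewrite unlock.
under eq_integral => w _.
  have -> : (cycle_count eta n j w)%:E =
      (\sum_(1 <= r < n.+2 | (r + j <= n.+1)%N) (\1_(A r) w)%:E :> \bar R)%E.
    rewrite sumEFin /cycle_count /spacings natr_sum; congr (_%:E).
    apply: eq_bigr => r _; rewrite indicE; congr (nat_of_bool _)%:R.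
    apply/idP/idP.
      move=> /and3P[ws /allP w0 wr]; rewrite inE => i /andP[ri ij].
      rewrite /spacing_pattern; have [->//|ir] := eqVneq i r.
      have [->//|irj] := eqVneq i (r + j)%N.
      by apply/negbTE/w0; rewrite mem_iota; lia.
    rewrite inE => hw; rewrite !hw /spacing_pattern ?eqxx ?orbT/=; [|lia..].
    rewrite andbT; apply/allP => i; rewrite mem_iota => ij.
    by rewrite hw /spacing_pattern; lia.
  over.
rewrite big_mkcond; under eq_integral do rewrite big_mkcond/=.
rewrite ge0_integral_sum//=; first last.
- by move=> r w _; case: ifP.
- move=> r; case: (r + j <= n.+1)%N; last exact: measurable_cst.
  exact/measurable_EFinP/measurable_indic.
rewrite -sumEFin; apply: eq_big_nat => r /andP[r1 _].
case: (boolP (r + j <= n.+1)%N) => rj; last by rewrite integral0.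
rewrite integral_indic// setIT -playground_spacing// -/(A r) fineK//.
exact: fin_num_measure.
Qed.

End playground_law.

(** * Rising factorials and Gauss's summation *)

Section rising_factorial.
Variable R : realType.
Implicit Types (x : R) (a m n t : nat).

Lemma rising0 x : rising x 0 = 1.
Proof. by rewrite /rising big_ord0. Qed.

Lemma risingS x m : rising x m.+1 = rising x m * (x + m%:R).
Proof. by rewrite /rising big_ord_recr. Qed.

Lemma risingSl x m : rising x m.+1 = x * rising (x + 1) m.
Proof.
rewrite /rising big_ord_recl addr0; congr (_ * _); apply: eq_bigr => i _.
by rewrite /= /bump/= natrD addrA.
Qed.

Lemma risingD x m n : rising x (m + n) = rising x m * rising (x + m%:R) n.
Proof.
elim: n => [|n IH]; first by rewrite addn0 rising0 mulr1.
by rewrite addnS !risingS IH natrD addrA mulrA.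
Qed.

Lemma rising_gt0 x m : 0 < x -> 0 < rising x m.
Proof. by move=> x0; apply: prodr_gt0 => i _; rewrite ltr_wpDr. Qed.

Lemma rising_neq0 x m : 0 < x -> rising x m != 0.
Proof. by move=> x0; rewrite gt_eqF// rising_gt0. Qed.

Lemma rising1 m : rising 1 m = m`!%:R :> R.
Proof.
elim: m => [|m IH]; first by rewrite rising0.
by rewrite risingS IH factS natrM mulrC nat1r.
Qed.

Lemma rising_ge1 x m : 1 <= x -> 1 <= rising x m.
Proof.
move=> x1; elim: m => [|m IH]; first by rewrite rising0.
by rewrite risingS mulr_ege1// ler_wpDr.
Qed.

Lemma rising_inv_cvg0 x t : 0 < x ->
  (rising (n%:R + x) t.+1)^-1 @[n --> \oo] --> 0.
Proof.
move=> x0; rewrite -[X in _ --> X](mulr0 (1 + x^-1)).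
apply: (@squeeze_cvgr _ _ _ _ (cst 0) (fun n => (1 + x^-1) * harmonic n)).
- near=> n; have nx : 0 < n%:R + x by rewrite ltr_wpDl.
  rewrite invr_ge0 ltW ?rising_gt0//= risingSl.
  have r1 : 1 <= rising (n%:R + x + 1) t by rewrite rising_ge1// lerDr ltW.
  apply: (@le_trans _ _ (n%:R + x)^-1).
    by rewrite lef_pV2 ?posrE ?mulr_gt0 ?(lt_le_trans ltr01 r1)//
      ler_peMr// ltW.
  rewrite /harmonic/= ler_pdivlMr// ler_pdivrMl// -natr1 mulrDr mulr1 mulrDl.
  rewrite divff ?gt_eqF//.
  have : 0 <= n%:R / x by rewrite divr_ge0// ltW.
  by move: x0 (n%:R / x) => + y; lra.
- by rewrite mulr0; exact: cvg_cst.
- by apply: cvgMl_tmp; exact: cvg_harmonic.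
Unshelve. all: by end_near.
Qed.

(** Over the common denominator [rising x t.+2], the difference has numerator
    [(x + t + 1) - x = t + 1]. *)
Lemma telescope_rising x t : 0 < x ->
  (rising x t.+2)^-1 =
  ((rising x t.+1)^-1 - (rising (x + 1) t.+1)^-1) / t.+1%:R.
Proof.
move=> x0; have x1 : 0 < x + 1 by rewrite addr_gt0.
have xt1 : x + 1 + t%:R != 0 by rewrite gt_eqF// ltr_wpDr.
have r0 := rising_neq0 t x1; have x0' := gt_eqF x0.
rewrite risingS [rising (x + 1) _]risingS !risingSl -[t.+1%:R]natr1.
by field; rewrite natr1 pnatr_eq0 xt1 r0 x0'.
Qed.

(* Gauss's theorem 2F1(a + 1, x; x + a + t + 2; 1) *)
Lemma cvg_series_rising a t x : 0 < x ->
  series (fun r => rising r.+1%:R a / rising (r%:R + x) (a + t).+2) @ \oo -->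
  a`!%:R * t`!%:R / ((a + t).+1`!%:R * rising x t.+1).
Proof.
move=> x0; elim: a t => [|a IH] t.
  (* For [a = 0] the series telescopes, with a boundary term tending to 0. *)
  rewrite add0n.
  have -> : series (fun r => rising r.+1%:R 0 / rising (r%:R + x) t.+2) =
      (fun n => ((rising x t.+1)^-1 - (rising (n%:R + x) t.+1)^-1) / t.+1%:R).
    apply/funext => n; rewrite /series/=.
    under eq_bigr do rewrite rising0 mul1r telescope_rising ?ltr_wpDl//.
    rewrite -mulr_suml; congr (_ / _).
    under eq_bigr do rewrite addrAC natr1.
    rewrite (@telescope_sumr_eq _ 0 n
      (fun r => - (rising (r%:R + x) t.+1)^-1))//.
      by rewrite add0r opprK addrC.
    by move=> i _; rewrite opprK [RHS]addrC.
  rewrite fact0 mul1r factS natrM invfM.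
  have -> : t`!%:R * (((t.+1)%:R * t`!%:R)^-1 / rising x t.+1) =
      ((rising x t.+1)^-1 - 0) / t.+1%:R :> R.
    rewrite subr0 invfM mulrA [t`!%:R * _]mulrC
      divfK ?pnatr_eq0 -?lt0n ?fact_gt0//.
    by rewrite mulrC.
  apply: cvgM; last exact: cvg_cst.
  by apply: cvgB; [exact: cvg_cst|exact: rising_inv_cvg0].
(* The new factor is [r + 1 + a = (r + x + a + t + 2) - (x + t + 1)]: the first part cancels a
   factor of the denominator, the second leaves the series for [t + 1]. *)
have -> : series (fun r => rising r.+1%:R a.+1 /
      rising (r%:R + x) (a.+1 + t).+2) =
    series (fun r => rising r.+1%:R a / rising (r%:R + x) (a + t).+2) \-
    (fun n => (x + t.+1%:R) *
      series (fun r => rising r.+1%:R a / rising (r%:R + x) (a + t.+1).+2) n).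
  apply/funext => n /=; rewrite /series/= mulr_sumr -sumrB.
  apply: eq_bigr => r _.
  have rx : 0 < r%:R + x by rewrite ltr_wpDl.
  rewrite addSnnS [rising _ a.+1]risingS.
  rewrite [rising (_ + x) (a + t.+1).+2]risingS addnS.
  have r0 := rising_neq0 (a + t).+2 rx.
  have r1 : r%:R + x + (a + t).+2%:R != 0 by rewrite gt_eqF// ltr_wpDr.
  move: r1; rewrite -!natr1 !natrD => r1.
  by field; rewrite r0 r1.
have -> : a.+1`!%:R * t`!%:R / ((a.+1 + t).+1`!%:R * rising x t.+1) =
    a`!%:R * t`!%:R / ((a + t).+1`!%:R * rising x t.+1) - (x + t.+1%:R) *
      (a`!%:R * t.+1`!%:R / ((a + t.+1).+1`!%:R * rising x t.+2)).
  rewrite addSnnS [rising x t.+2]risingS addnS !factS !natrM.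
  have r0 := rising_neq0 t.+1 x0.
  have xt : x + t.+1%:R != 0 by rewrite gt_eqF// ltr_wpDr.
  have f0 n : n`!%:R != 0 :> R by rewrite pnatr_eq0 -lt0n fact_gt0.
  have := f0 (a + t)%N; have : (a + t).+2%:R != 0 :> R by rewrite pnatr_eq0.
  have : (a + t).+1%:R != 0 :> R by rewrite pnatr_eq0.
  move: xt; rewrite -!natr1 !natrD => xt h1 h2 h3.
  by field; rewrite r0 xt h1 h2 h3.
by apply: cvgB; [exact: IH|apply: cvgM; [exact: cvg_cst|exact: IH]].
Qed.

End rising_factorial.

(** * Bounds and closed forms for the transition rates and weights *)

Section playground_rates.
Variables (R : realType) (theta : R).
Hypothesis theta0 : 0 < theta.
Implicit Types j r s k n : nat.

Lemma pg_p_ge0 r : 0 <= pg_p theta r.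
Proof.
by case: r => [|[|[|r]]]//=; rewrite divr_ge0// addr_ge0// ltW.
Qed.

Lemma pg_p_le1 r : pg_p theta r <= 1.
Proof.
case: r => [|[|[|r]]]//=; rewrite ler_pdivrMr ?mul1r ?lerDl ?(ltW theta0)//.
by rewrite addr_gt0.
Qed.

Lemma pg_q_ge0 r : 0 <= pg_q theta r.
Proof. by rewrite subr_ge0 pg_p_le1. Qed.

Lemma pg_q_le1 r : pg_q theta r <= 1.
Proof. by rewrite lerBlDr lerDl pg_p_ge0. Qed.

Lemma pg_qE r : pg_q theta r.+3 = theta / (r.+2%:R + theta).
Proof.
have rt : r.+2%:R + theta != 0 by rewrite gt_eqF// addr_gt0.
by rewrite /pg_q/= -[X in X - _](divff rt) -mulrBl addrAC subrr add0r.
Qed.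

(** The constant [1 + theta] also covers index 1, where [pg_q] equals 1. *)
Lemma pg_q_le_harmonic r : pg_q theta r.+1 <= (1 + theta) / r.+1%:R.
Proof.
rewrite ler_pdivlMr//; case: r => [|[|r]].
- by rewrite /pg_q/= subr0 mulr1 lerDl ltW.
- by rewrite /pg_q/= subrr mul0r addr_ge0// ltW.
have rt : 0 < r.+2%:R + theta by rewrite addr_gt0.
rewrite pg_qE mulrAC ler_pdivrMr// -[r.+3%:R]natr1.
have : 0 <= r.+2%:R :> R by rewrite ler0n.
have : 0 <= theta * theta by rewrite mulr_ge0 ?(ltW theta0).
by move: theta0 (r.+2%:R : R) => ? N ? ?; lra.
Qed.

(** The value of [pg_q theta] at 3, its maximum over indices at least 3. *)
Let rho := theta / (2 + theta).

Lemma pg_q_le_ratio r : pg_q theta r.+3 <= rho.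
Proof.
rewrite pg_qE ler_pM2l// lef_pV2 ?posrE ?addr_gt0// lerD2r ler_nat//.
Qed.

Lemma spacing_weight_ge0 j r : 0 <= spacing_weight theta j r.
Proof.
by rewrite mulr_ge0 ?pg_q_ge0//; apply: prodr_ge0 => i _; exact: pg_p_ge0.
Qed.

Lemma spacing_weight_le j r : spacing_weight theta j r <= pg_q theta r.
Proof.
rewrite ler_piMr ?pg_q_ge0//; apply: prodr_ile1 => i _.
by rewrite pg_p_ge0 pg_p_le1.
Qed.

Lemma spacing_weight2 j : spacing_weight theta j 2 = 0.
Proof. by rewrite /spacing_weight /pg_q/= subrr mul0r. Qed.

(** Up to [theta], this is the prefactor of the first integral in [main_term]; the factor
    [pg_p theta 2] is 1. *)
Lemma spacing_weight1 j : spacing_weight theta j.+3 1 =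
  j.+1`!%:R / rising (theta + 2) j.
Proof.
rewrite /spacing_weight /pg_q/= subr0 mul1r.
elim: j => [|j IH]; first by rewrite big_nat1/= rising0 divr1.
rewrite big_nat_recr//= IH risingS (factS j.+1) natrM invfM.
have -> : theta + 2 + j%:R = j.+2%:R + theta by rewrite -!natr1; ring.
by rewrite mulrACA [X in X * _]mulrC.
Qed.

(** The rates are uniform from index 3 on, hence the shift of the position; writing the size as
    [a.+2] removes truncated subtractions. *)
Lemma spacing_weightE a r : spacing_weight theta a.+2 r.+3 =
  theta * rising r.+3%:R a / rising (r.+2%:R + theta) a.+1.
Proof.
rewrite /spacing_weight pg_qE.
have -> : (r.+3 + a.+2).-1 = (r.+4 + a)%N by lia.
have rt : r.+2%:R + theta != 0 by rewrite gt_eqF// addr_gt0.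
elim: a => [|a IH].
  by rewrite addn0 big_geq// risingS !rising0 !mulr1 mul1r addr0.
rewrite addnS big_nat_recr/= ?leq_addr// mulrA IH [in RHS]risingS.
rewrite [rising (_ + theta) a.+2]risingS.
have -> : r.+2%:R + theta + a.+1%:R = (r.+2 + a).+1%:R + theta.
  by rewrite -addnS natrD addrAC.
have -> : r.+3%:R + a%:R = (r.+2 + a).+1%:R :> R by rewrite -natrD.
by rewrite mulrACA -invfM mulrA.
Qed.

End playground_rates.

(** * The limiting probabilities and their alternating expansion *)

Section limit_probability.
Variables (R : realType) (theta : R).
Hypothesis theta0 : 0 < theta.
Implicit Types j r s k m n a : nat.

(** The limit of the probability of a 1 at [s], used for [s >= 3], where the exponent is at least
    [theta + 1]. *)
Definition limit_prob s : R :=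
  theta * \int[lebesgue_measure]_(x in `[0, 1])
    beta_exp theta (theta + s%:R - 2) x.

Lemma limit_prob_ge0 s : 0 <= limit_prob s.
Proof.
rewrite mulr_ge0 ?(ltW theta0)// Rintegral_ge0// => x _.
by rewrite mulr_ge0 ?expR_ge0 ?powR_ge0.
Qed.

(** This is [integral_beta_exp_rec] at [a = theta + s + 1], whose denominator [a + 1] is that of
    [pg_q theta s.+3]. *)
Lemma limit_prob_rec s :
  limit_prob s.+3 = pg_q theta s.+3 * (1 - limit_prob s.+4).
Proof.
have e1 : 1 <= theta + s.+3%:R - 2.
  have : 0 <= s%:R :> R by [].
  by rewrite -!natr1; move: theta0 => + ?; lra.
have e2 : theta + s.+4%:R - 2 = theta + s.+3%:R - 2 + 1.
  by rewrite -[s.+4%:R]natr1; ring.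
rewrite /limit_prob e2 (integral_beta_exp_rec theta e1) pg_qE// mulrA mulrAC.
by congr (theta / _ * _); rewrite -!natr1; ring.
Qed.

Lemma limit_prob_le s : limit_prob s.+3 <= pg_q theta s.+3.
Proof.
by rewrite limit_prob_rec ler_piMr ?pg_q_ge0// gerBl limit_prob_ge0.
Qed.

Lemma limit_prob_le1 s : limit_prob s.+3 <= 1.
Proof. exact: le_trans (limit_prob_le s) (pg_q_le1 theta0 _). Qed.

Lemma main_termE j : (2 <= j)%N ->
  main_term theta j = spacing_weight theta j 1 * limit_prob j.+1.
Proof.
have E j' : theta + j'.+1%:R - 2 = theta + j'%:R - 1 :> R.
  by rewrite -natr1; ring.
case: j => [|[|[|j]]]// _.
  rewrite /main_term /= mul0r add0r mul1r /limit_prob E.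
  rewrite /spacing_weight big_geq// mulr1 /pg_q subr0 mul1r.
  by have -> : theta + 2 - 1 = theta + 1 by lra.
rewrite /main_term /= mul0r addr0 mul1r spacing_weight1 /limit_prob E.
rewrite !subSS !subn0.
rewrite -!mulrA mulrCA; congr (_ * _); exact: mulrCA.
Qed.

Definition alt_coef s k : R := \prod_(i < k) pg_q theta (s + i).

Lemma alt_coefE s k :
  alt_coef s.+3 k = theta ^+ k / rising (s.+2%:R + theta) k.
Proof.
rewrite /alt_coef; elim: k => [|k IH].
  by rewrite big_ord0 expr0 rising0 divr1.
rewrite big_ord_recr/= IH exprSr risingS invfM addnC !addnS pg_qE// mulrACA.
by congr (_ * (_ * _^-1)); rewrite -!addnS natrD -addrA addrC.
Qed.

Lemma limit_prob_expansion s m : limit_prob s.+3 =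
  \sum_(1 <= k < m.+1) (-1) ^+ k.+1 * alt_coef s.+3 k
  + (-1) ^+ m * alt_coef s.+3 m * limit_prob (s.+3 + m).
Proof.
move: limit_prob limit_prob_rec => v vE; elim: m => [|m IH].
  by rewrite big_geq// add0r expr0 /alt_coef big_ord0 !mul1r addn0.
rewrite [LHS]IH [in RHS]big_nat_recr//= -addrA; congr (_ + _).
rewrite /alt_coef big_ord_recr/= addnS !addSn vE !exprS.
by move: (\prod_(i < m) _) => c; ring.
Qed.

Lemma limit_prob_le_alt s m : limit_prob s.+3 <=
  \sum_(1 <= k < (2 * m).+2) (-1) ^+ k.+1 * alt_coef s.+3 k.
Proof.
rewrite (limit_prob_expansion s (2 * m).+1) gerDl exprS exprM sqrrN !expr1n.
rewrite mulr1 mulN1r mulNr oppr_le0 mulr_ge0 ?limit_prob_ge0//.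
by apply: prodr_ge0 => i _; exact: pg_q_ge0.
Qed.

End limit_probability.

(** * The numbers [bbar] as sums of series *)

Section bbar_series.
Variables (R : realType) (theta : R).
Hypothesis theta0 : 0 < theta.
Implicit Types j r s k m n a t : nat.

Lemma rising2 a : rising 2 a = a.+1`!%:R :> R.
Proof. by rewrite -rising1 risingSl mul1r. Qed.

(* The summand (r + 1)_(a) (r + theta + a + 1) / (r + theta)_(a + t + 3), split
   along r + theta + a + 1 = (r + theta) + (a + 1). *)
Definition gauss_term a t r : R := theta ^+ t.+2 *
  (rising r.+1%:R a / rising (r%:R + (theta + 1)) (a + t).+2 +
   a.+1%:R * (rising r.+1%:R a / rising (r%:R + theta) (a + t.+1).+2)).

(** The denominators of the weight and of the product of rates make up a rising factorial from [x]
    with only the factor [x + a + 1] missing; restoring it gives the numerator that [gauss_term]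
    splits. *)
Lemma spacing_alt_coefE a t i :
  spacing_weight theta a.+2 i.+3 * alt_coef theta (i.+3 + a.+2) t.+1 =
  gauss_term a t i.+2.
Proof.
rewrite spacing_weightE// /gauss_term.
have -> : (i.+3 + a.+2 = (i + a.+2).+3)%N by rewrite !addSn.
rewrite alt_coefE//; set x := i.+2%:R + theta.
have x0 : 0 < x by rewrite addr_gt0.
have -> : (i + a.+2).+2%:R + theta = x + a.+2%:R.
  by rewrite -!addSn natrD addrAC.
have rx : rising x (a + t.+1).+2 =
    rising x a.+1 * (x + a.+1%:R) * rising (x + a.+2%:R) t.+1.
  by rewrite -risingS -risingD addSn addSn.
have -> : rising (i.+2%:R + (theta + 1)) (a + t).+2 =
    rising x a.+1 * (x + a.+1%:R) * rising (x + a.+2%:R) t.+1 / x.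
  by rewrite -rx addnS [in RHS]risingSl mulrAC divff ?mul1r ?gt_eqF// addrA.
rewrite rx (exprS theta t.+1).
have h1 := rising_neq0 a.+1 x0.
have h2 : x + a.+1%:R != 0 by rewrite gt_eqF// ltr_wpDr.
have h3 : rising (x + a.+2%:R) t.+1 != 0 by rewrite rising_neq0// ltr_wpDr.
have h4 : x != 0 by rewrite gt_eqF.
rewrite -[a.+1%:R]natr1 in h2 *.
by field; rewrite h1 h2 h3 h4.
Qed.

(** The first fraction of [bbar] is the full sum of [gauss_term] given by [cvg_series_rising] at
    [theta + 1] and at [theta]; the second is its terms at 0 and 1. *)
Lemma bbarE a t : bbar t.+1 theta a.+2 =
  theta ^+ t.+2 *
   (a`!%:R * t`!%:R / ((a + t).+1`!%:R * rising (theta + 1) t.+1) +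
    a.+1%:R * (a`!%:R * t.+1`!%:R / ((a + t.+1).+1`!%:R * rising theta t.+2))) -
  (gauss_term a t 0 + gauss_term a t 1).
Proof.
have th1 : 0 < theta + 1 by rewrite addr_gt0.
have f0 n : n`!%:R != 0 :> R by rewrite pnatr_eq0 -lt0n fact_gt0.
have t0 : theta != 0 by rewrite gt_eqF.
have r0 m : rising (theta + 1) m != 0 by rewrite rising_neq0.
rewrite /bbar !subSS !subn0 /=; congr (_ - _).
  have -> : rising (a.+2%:R - 1) t.+2 = (a + t).+2`!%:R / a`!%:R :> R.
    rewrite -!rising1 -!addnS risingD mulrAC divff ?rising_neq0// mul1r.
    by congr (rising _ _); rewrite -natr1 addrK nat1r.
  rewrite [rising theta _]risingSl addnS (factS t) (factS (a + t).+1).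
  rewrite (natrM _ t.+1) (natrM _ (a + t).+2).
  rewrite (exprS theta t.+1).
  have n0 : (a + t).+2%:R != 0 :> R by rewrite pnatr_eq0.
  move: (f0 (a + t).+1) (f0 a) (r0 t.+1) n0.
  move: ((a + t).+1`!%:R : R) (a`!%:R : R) (t`!%:R : R) (rising _ t.+1).
  rewrite -!natr1 natrD => f1 f2 f3 u h1 h2 h3 h4.
  by field; rewrite h1 h2 h3 h4 t0.
have x0 : theta + 1 + (a + t).+2%:R != 0 by rewrite gt_eqF// ltr_wpDr.
have th1' : theta + 1 != 0 by rewrite gt_eqF.
have rE : rising (theta + 1 + 1) (a + t).+2 =
    rising (theta + 1) (a + t).+2 * (theta + 1 + (a + t).+2%:R) / (theta + 1).
  by rewrite -risingS [in RHS]risingSl mulrAC divff ?mul1r.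
have -> : (t.+1 + a.+2 = (a + t).+3)%N by lia.
rewrite /gauss_term !add0r rising1 rising2 addnS.
have -> : 1 + (theta + 1) = theta + 1 + 1 by rewrite addrC.
have -> : 1 + theta = theta + 1 by rewrite addrC.
rewrite [rising theta _]risingSl rE [rising _ (a + t).+3]risingS factS natrM.
rewrite (exprS theta t.+1).
move: (r0 (a + t).+2) x0; move: (a`!%:R : R) (rising _ _).
rewrite -!natr1 natrD => f u h1 h2.
by field; rewrite h1 h2 th1' t0.
Qed.

Lemma cvg_series_bbar a k : (1 <= k)%N ->
  series (fun i => spacing_weight theta a.+2 i.+3 *
    alt_coef theta (i.+3 + a.+2) k) @ \oo --> bbar k theta a.+2.
Proof.
case: k => // t _; rewrite bbarE.
(* Position [i + 3] matches index [i + 2] of [gauss_term], so two initial terms are removed. *)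
have -> : series (fun i => spacing_weight theta a.+2 i.+3 *
    alt_coef theta (i.+3 + a.+2) t.+1) =
    (fun n => series (gauss_term a t) (n + 2)%N -
              (gauss_term a t 0 + gauss_term a t 1)).
  apply/funext => n; rewrite /series/= addn2 big_nat_recl// big_nat_recl//.
  rewrite addrA [RHS]addrC addKr.
  by apply: eq_bigr => i _; rewrite spacing_alt_coefE.
apply: cvgB; last exact: cvg_cst.
rewrite (cvg_shiftn 2 (series (gauss_term a t) : nat -> R)).
have -> : series (gauss_term a t) = (fun n => theta ^+ t.+2 *
    (series (fun r =>
       rising r.+1%:R a / rising (r%:R + (theta + 1)) (a + t).+2) n +
     a.+1%:R * series (fun r =>
       rising r.+1%:R a / rising (r%:R + theta) (a + t.+1).+2) n)).
  apply/funext => n; rewrite /series/= [in X in _ + X]mulr_sumr.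
  by rewrite -big_split mulr_sumr.
apply: cvgM; first exact: cvg_cst.
apply: cvgD; first by apply: cvg_series_rising; rewrite addr_gt0.
by apply: cvgM; [exact: cvg_cst|exact: cvg_series_rising].
Qed.

End bbar_series.

(** * Passage to the limit in the weighted sums *)

(** By [tS], the bounds [t n <= c] and [n * t n <= c ^ 2] propagate together, through
    [x * c + 1 = c] and [x * c ^ 2 + c = c ^ 2]. *)
Lemma geometric_harmonic_sum_le (R : realType) (x : R) n : 0 <= x < 1 ->
  n%:R * \sum_(r < n) x ^+ (n - r.+1) / r.+1%:R <= (1 - x)^-1 ^+ 2.
Proof.
move=> /andP[x0 x1]; set c := (1 - x)^-1.
have x1' : 1 - x != 0 by rewrite subr_eq0 gt_eqF.
have c1 : x * c + 1 = c.
  by apply: (mulfI x1'); rewrite mulrDr mulrCA /c divff// !mulr1 addrC subrK.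
have c0 : 0 <= c by rewrite invr_ge0 subr_ge0 ltW.
pose t m : R := \sum_(r < m) x ^+ (m - r.+1) / r.+1%:R.
have tS m : t m.+1 = x * t m + m.+1%:R^-1.
  rewrite /t big_ord_recr/= subnn expr0 mul1r mulr_sumr; congr (_ + _).
  by apply: eq_bigr => r _; rewrite subSn// exprS mulrA.
suff [] : t n <= c /\ n%:R * t n <= c ^+ 2 by [].
elim: n => [|n [IH1 IH2]]; first by rewrite /t big_ord0 mul0r exprn_ge0.
rewrite tS; split.
  rewrite -[leRHS]c1 lerD ?ler_wpM2l// invf_le1// ler1n//.
rewrite mulrDr divff// -natr1 mulrDl mul1r mulrCA.
have xc : x * c ^+ 2 + c = c ^+ 2.
  by rewrite expr2 mulrA -[X in _ + X]mul1r -mulrDl c1.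
have := ler_wpM2l x0 IH1; have := ler_wpM2l x0 IH2.
move: c1 xc; move: (x * (n%:R * _)) (x * t n) (x * c) (x * c ^+ 2) (c ^+ 2).
by clear; move=> ? ? ? ? ? ? ? ? ?; lra.
Qed.

Section playground_limit.
Variables (R : realType) (theta : R).
Hypothesis theta0 : 0 < theta.
Implicit Types j r s k m n a : nat.

Let tail a i : R :=
  spacing_weight theta a.+2 i.+3 * limit_prob theta (i.+3 + a.+2).

Definition tail_limit a : R := limn (series (tail a)).

Lemma tail_le a m i : tail a i <=
  \sum_(1 <= k < (2 * m).+2) (-1) ^+ k.+1 *
    (spacing_weight theta a.+2 i.+3 * alt_coef theta (i.+3 + a.+2) k).
Proof.
rewrite /tail; under [leRHS]eq_bigr do rewrite mulrCA.
rewrite -mulr_sumr ler_wpM2l ?spacing_weight_ge0//.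
exact: limit_prob_le_alt.
Qed.

(** Comparison with the bound [tail_le] for [m = 0], whose only term is [k = 1]. *)
Lemma cvg_tail a : series (tail a) @ \oo --> tail_limit a.
Proof.
have := @cvg_series_bbar _ _ theta0 a 1 isT => h.
apply: (series_le_cvg _ _ _ (cvgP _ h)) => i.
- by rewrite mulr_ge0 ?spacing_weight_ge0 ?limit_prob_ge0.
- rewrite mulr_ge0 ?spacing_weight_ge0//; apply: prodr_ge0 => l _.
  exact: pg_q_ge0.
- by have := tail_le a 0 i; rewrite big_nat1 expr2 mulrNN !mul1r.
Qed.

(** The sum over [k] is finite, so it is exchanged with the partial sums over positions before the
    limit is taken. *)
Lemma tail_limit_le a m : tail_limit a <=
  \sum_(1 <= k < (2 * m).+2) (-1) ^+ k.+1 * bbar k theta a.+2.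
Proof.
rewrite big_add1/=.
pose b n := \sum_(0 <= k < (2 * m).+1) (-1) ^+ k.+2 *
  series (fun i => spacing_weight theta a.+2 i.+3 *
    alt_coef theta (i.+3 + a.+2) k.+1) n.
have bl : b @ \oo -->
    \sum_(0 <= k < (2 * m).+1) (-1) ^+ k.+2 * bbar k.+1 theta a.+2.
  apply: cvg_big => [|k _]; first exact: add_continuous.
  apply: cvgM; first exact: cvg_cst.
  exact: cvg_series_bbar.
apply: (ler_cvg_to (@cvg_tail a) bl); apply: nearW => n.
rewrite /b /series/=; under [leRHS]eq_bigr do rewrite mulr_sumr.
rewrite exchange_big/=; apply: ler_sum => i _.
by have := tail_le a m i; rewrite big_add1.
Qed.

Let rho : R := theta / (2 + theta).

(** Each step down multiplies the difference of two solutions by [- pg_q theta i]. The contraction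
    starts at [n], where the difference is at most 1, hence the exponent [s.-1]. *)
Lemma dist_limit_prob (u : nat -> R) n r s :
  u n.+1 = 1 -> u n = 0 ->
  (forall i, (2 <= i <= n.-1)%N -> u i = pg_q theta i * (1 - u i.+1)) ->
  (r.+3 + s = n.+1)%N ->
  `|u r.+3 - limit_prob theta r.+3| <= rho ^+ s.-1.
Proof.
move=> u1 u0 urec; have lp1 i := limit_prob_le1 theta0 i.
have lp0 i := limit_prob_ge0 theta0 i.
have [t0 t1] : 0 <= rho /\ 0 <= 2 + theta.
  by rewrite divr_ge0 ?addr_ge0 ?(ltW theta0).
case: s => [|s].
  by rewrite addn0 => rn; rewrite {1}rn u1 expr0 ger0_norm ?subr_ge0// gerBl.
elim: s r => [|s IH] r rs.
  have rn : r.+3 = n by lia.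
  by rewrite {1}rn u0 sub0r normrN expr0 ger0_norm.
rewrite urec; last by lia.
rewrite limit_prob_rec// -mulrBr opprB [X in _ * X]addrC addrA subrK normrM.
rewrite [rho ^+ _]exprS ger0_norm ?pg_q_ge0// ler_pM ?pg_q_ge0 ?pg_q_le_ratio//.
by rewrite distrC; apply: IH; lia.
Qed.

(** Here [n = m + a + 2], so a spacing of size [a + 2] fits exactly at the positions 1 to [m + 1].
    Geometric errors meet weights of order [1 / r]. *)
Lemma dist_weighted_sum (u : nat -> R) a m :
  u (m + a).+3 = 1 -> u (m + a).+2 = 0 ->
  (forall i, (2 <= i <= (m + a).+1)%N -> u i = pg_q theta i * (1 - u i.+1)) ->
  `|\sum_(r < m.+1) spacing_weight theta a.+2 r.+1 * u (r.+1 + a.+2)%N -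
    \sum_(r < m.+1) spacing_weight theta a.+2 r.+1 *
      limit_prob theta (r.+1 + a.+2)|
  <= (1 + theta) / rho * (1 - rho)^-1 ^+ 2 * harmonic m.
Proof.
move=> u1 u0 urec; have th2 : 0 < 2 + theta by rewrite addr_gt0.
have rho0 : 0 < rho by rewrite divr_gt0.
have rho1 : rho < 1 by rewrite ltr_pdivrMr// mul1r ltrDr.
rewrite -sumrB; apply: le_trans (ler_norm_sum _ _ _) _.
(* The factor [1 / rho] compensates the truncated exponent [s.-1], including at [s = 0], where the
   error bound is 1. *)
apply: (@le_trans _ _ (\sum_(r < m.+1)
    (1 + theta) / rho * (rho ^+ (m.+1 - r.+1) / r.+1%:R))).
  apply: ler_sum => r _; rewrite -mulrBr normrM ger0_norm ?spacing_weight_ge0//.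
  have -> : (1 + theta) / rho * (rho ^+ (m.+1 - r.+1) / r.+1%:R) =
      (1 + theta) / r.+1%:R * (rho^-1 * rho ^+ (m - r)).
    by rewrite subSS [X in _ * X = _]mulrC mulrACA.
  apply: ler_pM => //; first exact: spacing_weight_ge0.
    exact: le_trans (spacing_weight_le _ _ _) (pg_q_le_harmonic _ _).
  have -> : (r.+1 + a.+2 = (r + a).+3)%N by lia.
  have rm : ((r + a).+3 + (m - r) = (m + a).+3)%N by have := ltn_ord r; lia.
  apply: le_trans (@dist_limit_prob u (m + a).+2 _ _ u1 u0 urec rm) _.
  case: (m - r)%N => [|s]/=; first by rewrite !expr0 mulr1 invf_ge1// ltW.
  by rewrite exprS mulKf// gt_eqF.
rewrite -mulr_sumr -[leRHS]mulrA ler_wpM2l ?divr_ge0 ?addr_ge0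
  ?(ltW theta0) ?(ltW rho0)//.
rewrite /harmonic ler_pdivlMr// mulrC geometric_harmonic_sum_le//.
by rewrite rho1 ltW.
Qed.

Lemma cvg_limit_weighted_sum a :
  \sum_(r < n.+2) spacing_weight theta a.+2 r.+1 *
    limit_prob theta (r.+1 + a.+2) @[n --> \oo] -->
  main_term theta a.+2 + tail_limit a.
Proof.
rewrite main_termE//.
have -> : (fun n => \sum_(r < n.+2) spacing_weight theta a.+2 r.+1 *
    limit_prob theta (r.+1 + a.+2)) = (fun n =>
    spacing_weight theta a.+2 1 * limit_prob theta a.+3 + series (tail a) n).
  apply/funext => n; rewrite 2!big_ord_recl spacing_weight2 mul0r add0r.
  by rewrite /series/= big_mkord.
by apply: cvgD; [exact: cvg_cst|exact: cvg_tail].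
Qed.

(** The sequence [u m] belongs to the process with [n = m + a + 3]; its weighted sum differs from
    that of [limit_prob] by [O(1 / m)]. *)
Lemma cvg_weighted_sum (u : nat -> nat -> R) a :
  (forall m, u m (m + a).+4 = 1) -> (forall m, u m (m + a).+3 = 0) ->
  (forall m i, (2 <= i <= (m + a).+2)%N ->
    u m i = pg_q theta i * (1 - u m i.+1)) ->
  \sum_(r < m.+2) spacing_weight theta a.+2 r.+1 * u m (r.+1 + a.+2)%N
    @[m --> \oo] --> main_term theta a.+2 + tail_limit a.
Proof.
move=> u1 u0 urec; apply: (cvg_sub0 _ (cvg_limit_weighted_sum (a := a))).
apply: norm_cvg0; set C := (1 + theta) / rho * (1 - rho)^-1 ^+ 2.
apply: (@squeeze_cvgr _ _ _ _ (cst 0) (fun m => C * harmonic m.+1)).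
- apply: nearW => m; rewrite normr_ge0/=.
  by apply: (@dist_weighted_sum (u m) a m.+1);
    [exact: u1|exact: u0|exact: urec].
- exact: cvg_cst.
- rewrite -(mulr0 C); apply: cvgMl_tmp.
  by rewrite (cvg_shiftS (@harmonic R)); exact: cvg_harmonic.
Qed.

End playground_limit.

Theorem proposition1 (R : realType) :
  exists eps : nat -> R -> nat -> R,
  forall (theta : R) (j m : nat), 0 < theta -> (2 <= j)%N -> (1 <= m)%N ->
    eps m theta j <= bbar (2 * m).+1 theta j /\
    forall (d : nat -> measure_display) (T : forall n, measurableType (d n))
      (P : forall n, probability (T n) R)
      (eta : forall n, nat -> {RV (P n) >-> bool}),
      (forall n, (2 <= n)%N -> playground theta n (eta n)) ->
      ('E_(P n)[cycle_count (eta n) n j])%E @[n --> \oo] -->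
        (main_term theta j
         + \sum_(1 <= k < (2 * m).+1) (-1) ^+ k.+1 * bbar k theta j
         + eps m theta j)%:E.
Proof.
(* The error is the exact difference between the limiting sum over positions from 3 on and the
   partial alternating sum; it depends on no process. *)
exists (fun m theta j => tail_limit theta (j - 2) -
  \sum_(1 <= k < (2 * m).+1) (-1) ^+ k.+1 * bbar k theta j).
move=> theta [|[|a]]// m theta0 _ _; rewrite !subSS subn0; split.
  have := tail_limit_le theta0 a m; rewrite big_nat_recr//=.
  by rewrite -[in X in _ + X]signr_odd/= oddM/= mul1r lerBlDl.
move=> d T P eta pg; rewrite addrACA subrr addr0.
(* Shifting [n] by [a + 3] guarantees [n >= 2] and leaves at least the positions 1 and 2. *)
pose u m i : R := fine (P (m + a.+3)%N (eta (m + a.+3)%N i @^-1` [set true])).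
have pgm n : playground theta (n + a.+3) (eta (n + a.+3)%N).
  by apply: pg; rewrite addnS ltnS addnS.
rewrite -(cvg_shiftn a.+3 (fun n => 'E_(P n)[cycle_count (eta n) n a.+2])%E).
have -> : (fun n => 'E_(P (n + a.+3)%N)[
      cycle_count (eta (n + a.+3)%N) (n + a.+3)%N a.+2])%E =
    (fun n => (\sum_(r < n.+2)
      spacing_weight theta a.+2 r.+1 * u n (r.+1 + a.+2)%N)%:E).
  apply/funext => n; rewrite (expectation_cycle_count (pgm n))//.
  congr (_%:E); rewrite big_add1/= -(big_mkord xpredT (fun r =>
    spacing_weight theta a.+2 r.+1 * u n (r.+1 + a.+2)%N)).
  (* The constraint that the spacing fits amounts to [r < n.+2] for the position [r.+1]. *)
  rewrite [RHS](big_nat_widen _ _ (n + a.+3).+1); last by lia.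
  by apply: eq_bigl => r /=; lia.
apply: cvg_EFin; first exact: nearW.
apply: cvg_weighted_sum => // [n|n|n i ni].
- have -> : ((n + a).+4 = (n + a.+3).+1)%N by lia.
  exact: playground_prob_start (pgm n).
- have -> : ((n + a).+3 = n + a.+3)%N by lia.
  exact: playground_prob_top (pgm n).
- by apply: (playground_rec (pgm n)); rewrite !addnS.
Qed.
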